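(* Let $A$ be a finite alphabet with $|A|=r\ge2$ and let $0<d<\frac1{16}$. Let $\mathcal{R}_{\le n}$ be the set of reduced words over $\tilde A=A\sqcup A^{-1}$ of length at most $n$. Then a tuple of $|\mathcal{R}_{\le n}|^d$ reduced words of length at most $n$, chosen uniformly at random (i.e. the entries are independent and uniform in $\mathcal{R}_{\le n}$), exponentially generically generates a malnormal subgroup of the free group $F(A)$.
   Context: A word over $\tilde A$ is reduced if it has no factor $aa^{-1}$ with $a\in\tilde A$; $F(A)$ is the set of reduced words with product ''concatenate and reduce''. When a quantity such as $|\mathcal{R}_{\le n}|^d$ is not an integer, its integer part is meant. A subgroup $H$ of a group $G$ is malnormal if $H\cap g^{-1}Hg$ is trivial for every $g\in G\setminus H$. A property holds exponentially generically if the probability that it fails is $o(e^{-cn})$ for some $c>0$ as $n\to\infty$. *)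

(* Defs.v *)
From HB Require Import structures.
From mathcomp Require Import all_boot all_order all_algebra.
From mathcomp Require Import all_classical all_reals all_analysis.

Set Implicit Arguments.
Unset Strict Implicit.
Unset Printing Implicit Defensive.

Import Order.TTheory GRing.Theory Num.Theory.
Import numFieldNormedType.Exports.

Local Open Scope classical_set_scope.

(* The symmetrized alphabet A \sqcup A^-1: (a, true) is the letter a and
   (a, false) is its formal inverse. *)
Definition letter (A : finType) : finType := (A * bool)%type.

Definition linv (A : finType) (x : letter A) : letter A := (x.1, ~~ x.2).

Definition reduced (A : finType) (w : seq (letter A)) : bool :=
  sorted (fun x y => y != linv x) w.

Section Reduction.
Variable A : finType.
Implicit Types (x : letter A) (u v w : seq (letter A)).

(* Left multiplication of a reduced word by a letter. *)
Definition push x w : seq (letter A) :=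
  if w is y :: w' then if y == linv x then w' else x :: w else [:: x].

Definition reduce w : seq (letter A) := foldr push [::] w.

Lemma linvK : involutive (@linv A).
Proof. by case=> a b; rewrite /linv /= negbK. Qed.

Lemma push_reduced x w : reduced w -> reduced (push x w).
Proof.
case: w => [|y w] //=; case: eqVneq => [_ /path_sorted //|neq pw].
by rewrite /reduced /= neq.
Qed.

Lemma foldr_push_reduced u w : reduced w -> reduced (foldr push w u).
Proof. by move=> rw; elim: u => //= x u; exact: push_reduced. Qed.

Lemma reduce_reduced w : reduced (reduce w).
Proof. exact: foldr_push_reduced. Qed.

Lemma reduce_id w : reduced w -> reduce w = w.
Proof.
elim: w => //= x w IHw pw; rewrite IHw; last exact: path_sorted pw.
by case: w pw {IHw} => //= y w /andP[/negPf-> _].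
Qed.

Lemma pushK x w : reduced w -> push x (push (linv x) w) = w.
Proof.
case: w => [|y w] /=; first by rewrite eqxx.
rewrite linvK; case: eqVneq => [-> |neq] /=; last by rewrite eqxx.
by case: w => //= z w /andP[/negPf-> _].
Qed.

Lemma pushVK x w : reduced w -> push (linv x) (push x w) = w.
Proof. by move=> rw; rewrite -{2}(linvK x) pushK. Qed.

Lemma foldr_reduce u w : reduced w -> foldr push w (reduce u) = foldr push w u.
Proof.
move=> rw; elim: u => //= x u <-.
case def_v: (reduce u) (reduce_reduced u) => [|y v] //= rv.
case: eqVneq => [-> |_] //=.
by rewrite pushK // foldr_push_reduced.
Qed.

Lemma reduce_cat u v : reduce (u ++ v) = foldr push (reduce v) u.
Proof. by rewrite /reduce foldr_cat. Qed.

Definition winv w : seq (letter A) := rev (map (@linv A) w).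

Lemma winv_reduced w : reduced w -> reduced (winv w).
Proof.
rewrite /winv /reduced rev_sorted sorted_map; apply: sub_sorted => x y /=.
by apply: contra => /eqP ->; rewrite !linvK.
Qed.

Lemma winvK : involutive winv.
Proof. by move=> w; rewrite /winv map_rev revK mapK //; exact: linvK. Qed.

Lemma foldr_winvK w v : reduced v -> foldr push (foldr push v w) (winv w) = v.
Proof.
move=> rv; elim: w => //= x w IHw.
rewrite /winv /= rev_cons -cats1 foldr_cat /= pushVK //.
exact: foldr_push_reduced.
Qed.

End Reduction.

(* The free group F(A): reduced words under concatenation and reduction. *)
Record freegroup (A : finType) := FreeWord {
  fgval :> seq (letter A);
  fgvalP : reduced fgval }.

HB.instance Definition _ (A : finType) := [isSub for @fgval A].
HB.instance Definition _ (A : finType) := [Countable of freegroup A by <:].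

Section FreeGroup.
Variable A : finType.
Implicit Types f g h : freegroup A.

Definition fgone : freegroup A := FreeWord (isT : reduced (Nil (letter A))).
Definition fgmul f g : freegroup A := FreeWord (reduce_reduced (f ++ g)).
Definition fginv f : freegroup A := FreeWord (winv_reduced (fgvalP f)).

Lemma fgmulA : associative fgmul.
Proof.
move=> f g h; apply: val_inj => /=.
rewrite reduce_cat (reduce_id (reduce_reduced _)) [RHS]reduce_cat.
by rewrite foldr_reduce ?reduce_reduced // foldr_cat [in LHS]reduce_cat.
Qed.

Lemma fgmul1 : left_id fgone fgmul.
Proof. by move=> f; apply: val_inj; apply: reduce_id; exact: fgvalP. Qed.

Lemma fgmulr1 : right_id fgone fgmul.
Proof. by move=> f; apply: val_inj; rewrite /= cats0 reduce_id //; exact: fgvalP. Qed.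

Lemma fgmulV : left_inverse fgone fginv fgmul.
Proof.
move=> f; apply: val_inj => /=.
by rewrite reduce_cat; exact: (@foldr_winvK A f [::]).
Qed.

Lemma fgmulrV : right_inverse fgone fginv fgmul.
Proof.
move=> f; apply: val_inj => /=.
by rewrite reduce_cat; have := @foldr_winvK A (winv f) [::]; rewrite winvK; apply.
Qed.

End FreeGroup.

HB.instance Definition _ (A : finType) := isGroup.Build (freegroup A)
  (@fgmulA A) (@fgmul1 A) (@fgmulr1 A) (@fgmulV A) (@fgmulrV A).

Section Subgroups.
Variable G : groupType.
Implicit Types H X : set G.
Local Open Scope group_scope.

Definition subgroup H : Prop :=
  [/\ H 1, forall x y, H x -> H y -> H (x * y) & forall x, H x -> H x^-1].

Definition generated X : set G := smallest subgroup X.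

Lemma generated_subgroup X : subgroup (generated X).
Proof.
split=> [K [[]] //|x y Hx Hy K KP|x Hx K KP]; case: (KP) => -[K1 KM KV] _.
  by apply: KM; [exact: Hx | exact: Hy].
by apply: KV; exact: Hx.
Qed.

(* Here x ^ g is the conjugate g^-1 x g. *)
Definition malnormal H : Prop :=
  subgroup H /\ forall g, ~ H g -> H `&` [set x ^ g | x in H] = [set 1].

End Subgroups.

Local Open Scope ring_scope.

(* The reduced words of length at most n, as a finite type. *)
Definition reduced_le (A : finType) (n : nat) : finType :=
  {w : n.-bseq (letter A) | reduced w}.

Definition to_freegroup (A : finType) (n : nat) (w : reduced_le A n) :
  freegroup A := FreeWord (valP w).

Definition unif_prob (R : realType) (T : finType) (E : T -> Prop) : R :=
  #|[pred x | `[< E x >]]|%:R / #|T|%:R.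

Definition exp_generic (R : realType) (T : nat -> finType)
    (P : forall n, T n -> Prop) : Prop :=
  exists2 c : R, 0 < c &
    (fun n => unif_prob R (fun t : T n => ~ P n t))
      =o_\oo (fun n => expR (- (c * n%:R))).

(* The integer part of |R_{<= n}|^d. *)
Definition tuple_size (R : realType) (A : finType) (d : R) (n : nat) : nat :=
  Num.truncn (#|reduced_le A n|%:R `^ d).

Definition tuple_subgroup (A : finType) (n k : nat)
    (t : k.-tuple (reduced_le A n)) : set (freegroup A) :=
  generated (range (fun i : 'I_k => to_freegroup (tnth t i))).

(* Main.v *)
Require Import Defs.
From mathcomp Require Import all_boot all_order all_algebra.
From mathcomp Require Import all_classical all_reals all_analysis.
From mathcomp Require Import zify ring lra.

(** Let q = 2r - 1 and l = n / 7.  If every h_i has length at least 5l and no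
    word of length l occurs at two different places in the words h_i and their
    inverses, then fewer than l letters cancel between consecutive factors of
    a reduced product of generators and inverses.  If g^-1 f g lies in H for some f <> 1 in
    H, the reduced forms of f^N and g^-1 f^N g share a long factor when N is
    large; some window of length l of this factor lies inside a single block
    of both products, hence inside the same block at the same place,
    and comparing the prefixes of the two products gives g \in H.

    A coincidence of two factors of length l determines l letters of one
    entry of the tuple from its earlier letters and the other entries, so it
    has probability at most (n+1) 2r q^-l.  There are O(k^2 n^2) coincidences
    to exclude, and k^2 <= |R_{<= n}|^(1/8) is of order at most n q^(n/8),
    which q^(n/7) dominates. *)

Set Implicit Arguments.
Unset Strict Implicit.
Unset Printing Implicit Defensive.

Import Order.TTheory GRing.Theory Num.Theory.

(** * Inverses and cancellation in reduced words *)

Section Words.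
Variable A : finType.
Implicit Types (x y : letter A) (a b c u v w : seq (letter A)).

Lemma linv_neq x : linv x != x.
Proof. by case: x => a [] /=; rewrite /linv /= xpair_eqE eqxx. Qed.

Lemma winv_cat u v : winv (u ++ v) = winv v ++ winv u.
Proof. by rewrite /winv map_cat rev_cat. Qed.

Lemma winv_cons x u : winv (x :: u) = rcons (winv u) (linv x).
Proof. by rewrite /winv /= rev_cons. Qed.

Lemma size_winv u : size (winv u) = size u.
Proof. by rewrite size_rev size_map. Qed.

Lemma nth_winv x0 u i :
  i < size u -> nth x0 (winv u) i = linv (nth x0 u (size u - i.+1)).
Proof.
move=> lt_i; rewrite /winv nth_rev size_map // (nth_map x0) //.
by rewrite ltn_subrL; case: (size u) lt_i.
Qed.

Lemma reduced_nth x0 w i :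
  reduced w -> i.+1 < size w -> nth x0 w i.+1 != linv (nth x0 w i).
Proof. by rewrite /reduced => /(sortedP x0) /[apply]. Qed.

(** Here [b] is the part of [u] that cancels. A letter added in front of [u] can cancel only when
    [a] is empty, since [u] is reduced. *)
Lemma reduce_cat_split u v : reduced u -> reduced v ->
  exists a b c, [/\ u = a ++ b, v = winv b ++ c & reduce (u ++ v) = a ++ c].
Proof.
elim: u => [|x u IHu] ru rv.
  by exists [::], [::], v; rewrite /= reduce_id.
have [a [b [c [eq_u eq_v eq_uv]]]] := IHu (path_sorted ru) rv.
rewrite /= -/(reduce _) eq_uv; case: a => [|y a] in eq_u eq_uv *; last first.
  exists (x :: y :: a), b, c; rewrite eq_u /=; split=> //.
  by move: ru; rewrite eq_u /reduced /= => /andP[/negPf-> _].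
rewrite /= in eq_u eq_uv *; case: c => [|y c] in eq_v eq_uv *.
  by exists [:: x], b, [::]; rewrite eq_u.
have [def_y|/negPf neq] := eqVneq y (linv x); last first.
  by exists [:: x], b, (y :: c); rewrite eq_u /push neq.
exists [::], (x :: u), c; split=> //=; last by rewrite def_y eqxx.
by rewrite winv_cons cat_rcons -def_y eq_v eq_u.
Qed.

(* Comparing two occurrences of a letter reflected about the centre shows that
   a word equal to its own inverse near its centre is not reduced. *)
Lemma reflected_not_reduced x0 w i j : reduced w -> i <= j < size w ->
  (forall m, m.*2 <= j - i -> nth x0 w (i + m) = linv (nth x0 w (j - m))) -> False.
Proof.
move=> rw /andP[le_ij lt_j] eq_w; have [m] := ubnP (j - i).
elim: m i j le_ij lt_j eq_w => // m IHm i j le_ij lt_j eq_w lt_m.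
have [eq_ij|lt1] := leqP j i.
  have := eq_w 0 isT; rewrite addn0 subn0 (_ : j = i); last lia.
  by move/eqP; rewrite eq_sym (negPf (linv_neq _)).
have [eq_ij|lt2] := leqP j i.+1.
  have /eqP := eq_w 0 isT; rewrite addn0 subn0 (_ : j = i.+1); last lia.
  rewrite -(inj_eq (can_inj (@linvK A))) linvK eq_sym => /eqP eq1.
  have := @reduced_nth x0 w i rw ltac:(lia).
  by rewrite eq1 eqxx.
apply: (IHm i.+1 j.-1) => //; try lia.
move=> p le_p; have := eq_w p.+1 ltac:(lia).
by rewrite addnS addSn (_ : j - p.+1 = j.-1 - p); last lia.
Qed.

End Words.

(** * Growth of powers and conjugation in the free group *)

Section FreeGroupWords.
Variable A : finType.
Local Open Scope group_scope.
Implicit Types f g h : freegroup A.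

Lemma fg_valM f g : f * g = reduce (f ++ g) :> seq (letter A).
Proof. by []. Qed.

Lemma fg_valV f : f^-1 = winv f :> seq (letter A).
Proof. by []. Qed.

(** If half of [f] or more cancelled in [f * f], then [f] would agree with its own inverse at its
    centre, which reducedness excludes. *)
Lemma size_square_gt f : f != 1 -> size f < size (f * f).
Proof.
move=> f1; have rf := fgvalP f.
have f0 : size f != 0%N by apply: contra f1 => /nilP f0; apply/eqP/val_inj.
have [a [b [c [eq1 eq2 eq3]]]] := reduce_cat_split rf rf.
rewrite fg_valM eq3 size_cat.
have [x0 _] : exists x0 : letter A, true.
  by case: (f : seq _) f0 => // x; exists x.
have sz1 : size f = (size a + size b)%N by rewrite eq1 size_cat.
have sz2 : size f = (size b + size c)%N by rewrite eq2 size_cat size_winv.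
suff : (size b).*2 < size f by lia.
rewrite ltnNge; apply/negP => le_b.
have [i [j [le_ij eq_ij le_i]]] :
    exists i j, [/\ i <= j, i + j = (size f).-1 & j <= i.+1]%N.
  by exists ((size f).-1)./2, ((size f).-1 - ((size f).-1)./2)%N; split; lia.
apply: (@reflected_not_reduced _ x0 f i j) => //; first by lia.
move=> m le_m.
have lt_b : i + m < size b by lia.
rewrite [in LHS]eq2 nth_cat size_winv lt_b nth_winv //.
rewrite [in RHS]eq1 nth_cat ifF; last by lia.
by congr (linv (nth _ _ _)); lia.
Qed.

(** The exponent doubles at each step; the power stays nontrivial because squaring lengthens it. *)
Lemma size_expg_unbounded f m : f != 1 -> exists N, m <= size (f ^+ N).
Proof.
move=> f1; suff [N _ ?] : exists2 N, f ^+ N != 1 & m <= size (f ^+ N) by exists N.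
elim: m => [|m [N fN1 le_m]]; first by exists 1%N; rewrite ?expg1.
exists (N + N)%N; rewrite expgnDr; have lt_m := size_square_gt fN1.
  by apply/negP => /eqP eq1; rewrite eq1 in lt_m.
exact: leq_ltn_trans lt_m.
Qed.

(** At most [size g] letters cancel in each product. The factor [c] is the part of [u] past the
    prefix of [g] that survives in [g * v] and before the suffix of [u] that cancels against [g]. *)
Lemma conjg_overlap u v g m : u * g = g * v -> (size g).*2 + m <= size u ->
  exists a c b d e, [/\ u = a ++ c ++ b :> seq (letter A),
    v = d ++ c ++ e :> seq (letter A), m <= size c &
    g = a ++ winv d :> seq (letter A)].
Proof.
move=> /(congr1 (@fgval A)); rewrite !fg_valM => eq_ug le_u.
have [a1 [b1 [c1 [eq1 eq2 eq3]]]] := reduce_cat_split (fgvalP u) (fgvalP g).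
have [a2 [b2 [c2 [eq4 eq5 eq6]]]] := reduce_cat_split (fgvalP g) (fgvalP v).
have eq7 : a1 ++ c1 = a2 ++ c2 by rewrite -eq3 -eq6.
have sz1 : size u = (size a1 + size b1)%N by rewrite eq1 size_cat.
have sz2 : size g = (size b1 + size c1)%N by rewrite eq2 size_cat size_winv.
have sz4 : size g = (size a2 + size b2)%N by rewrite eq4 size_cat.
pose c := drop (size a2) a1.
have eq_a1 : a1 = a2 ++ c.
  have le_a : size a2 <= size a1 by lia.
  rewrite -{1}(cat_take_drop (size a2) a1); congr (_ ++ _).
  by move: (congr1 (take (size a2)) eq7); rewrite takel_cat // take_size_cat.
have eq_c2 : c2 = c ++ c1.
  move: (congr1 (drop (size a2)) eq7).
  by rewrite eq_a1 -catA !drop_size_cat.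
exists a2, c, b1, (winv b2), c1; rewrite winvK; split=> //.
- by rewrite eq1 eq_a1 -catA.
- by rewrite eq5 eq_c2.
- by rewrite size_drop; lia.
Qed.

End FreeGroupWords.

(** * Words in the generators of a subgroup *)

Section GeneratedSubgroups.
Variables (A I : finType) (h : I -> freegroup A).
Local Open Scope group_scope.
Implicit Types (x y : letter I) (w : seq (letter I)) (u v : seq (letter A)).
Implicit Types f g : freegroup A.

Definition fgword u : freegroup A := FreeWord (reduce_reduced u).

Lemma fgword_cat u v : fgword (u ++ v) = fgword u * fgword v.
Proof.
apply: val_inj; rewrite /= reduce_cat [RHS]reduce_cat.
by rewrite (reduce_id (reduce_reduced v)) foldr_reduce // reduce_reduced.
Qed.

Lemma fgword_id f : fgword f = f.
Proof. by apply: val_inj; rewrite /= reduce_id //; exact: fgvalP. Qed.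

Lemma fgword_winv u : fgword (winv u) = (fgword u)^-1.
Proof.
have -> : fgword (winv u) = fgword (winv u) * (fgword u * (fgword u)^-1).
  by rewrite mulgV mulg1.
rewrite mulgA -fgword_cat (_ : fgword _ = 1) ?mul1g //.
by apply: val_inj; rewrite /= reduce_cat; exact: foldr_winvK.
Qed.

(** Letters over [I] stand for the generators and their formal inverses, so [sprod] is the induced
    homomorphism from words over [I]. *)
Definition sgen x : freegroup A := if x.2 then h x.1 else (h x.1)^-1.

Definition sprod w : freegroup A := foldr (fun x f => sgen x * f) 1 w.

Lemma sgen_linv x : sgen (linv x) = (sgen x)^-1.
Proof. by case: x => i []; rewrite /sgen //= invgK. Qed.

Lemma sprod_cat w w' : sprod (w ++ w') = sprod w * sprod w'.
Proof. by elim: w => [|x w IHw] /=; rewrite ?mul1g // IHw mulgA. Qed.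

Lemma sprod_winv w : sprod (winv w) = (sprod w)^-1.
Proof.
elim: w => [|x w IHw] /=; first by rewrite invg1.
by rewrite winv_cons -cats1 sprod_cat IHw /= mulg1 sgen_linv invgM.
Qed.

Lemma sprod_reduce w : sprod (reduce w) = sprod w.
Proof.
elim: w => //= x w <-; case: (reduce w) => [|y v] //=.
by case: eqP => // ->; rewrite sgen_linv mulgA mulgV mul1g.
Qed.

Lemma generated_sprod w : generated (range h) (sprod w).
Proof.
have [H1 HM HV] := generated_subgroup (range h).
elim: w => //= x w IHw; apply: (HM) => //.
have Hh i : generated (range h) (h i) by move=> K [_]; apply; exists i.
by rewrite /sgen; case: ifP => _; [|apply: HV].
Qed.

Lemma generatedP f : generated (range h) f -> exists2 w, reduced w & f = sprod w.
Proof.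
suff sub : (generated (range h) `<=` [set f | exists w, f = sprod w])%classic.
  by move=> /sub[w ->]; exists (reduce w); rewrite ?reduce_reduced ?sprod_reduce.
apply: smallest_sub; last by move=> _ [i _ <-]; exists [:: (i, true)]; rewrite /= mulg1.
split; first by exists [::].
  by move=> _ _ [w ->] [w' ->]; exists (w ++ w'); rewrite sprod_cat.
by move=> _ [w ->]; exists (winv w); rewrite sprod_winv.
Qed.

(** * Malnormality under a small cancellation hypothesis *)

Variable l : nat.
Hypothesis l_gt0 : 0 < l.
Hypothesis size_h : forall i, 5 * l <= size (h i).
Hypothesis factor_inj : forall x y s t,
  s + l <= size (sgen x) -> t + l <= size (sgen y) ->
  take l (drop s (sgen x)) = take l (drop t (sgen y)) -> x = y /\ s = t.

Let H := generated (range h).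

Lemma size_sgen x : 5 * l <= size (sgen x).
Proof. by rewrite /sgen; case: ifP => _; rewrite ?fg_valV ?size_winv. Qed.

(** By induction the first [l] letters of [sgen y] survive in the product starting with [y]. If [l]
    letters cancelled against [sgen x], they would also begin [sgen (linv x)], forcing
    [y = linv x]. *)
Lemma sprod_cons_split x w : reduced (x :: w) ->
  exists a b c, [/\ sgen x = a ++ b :> seq (letter A),
    sprod w = winv b ++ c :> seq (letter A),
    sprod (x :: w) = a ++ c :> seq (letter A) & size b < l].
Proof.
elim: w x => [|y w IHw] x rw.
  exists (sgen x), [::], [::]; rewrite !cats0; split=> //.
  by congr (fgval _); exact: mulg1.
have [a [b [c [eq1 eq2 eq3]]]] :=
  reduce_cat_split (fgvalP (sgen x)) (fgvalP (sprod (y :: w))).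
exists a, b, c; split=> //; rewrite ltnNge; apply/negP => le_b.
have [a' [b' [c' [eq4 _ eq6 lt_b']]]] := IHw y (path_sorted rw).
have sz_a' : l <= size a'.
  by have := size_sgen y; rewrite eq4 size_cat; lia.
case/andP: rw => /eqP neq _; apply: neq.
have [|||-> //] := @factor_inj y (linv x) 0 0.
  by have := size_sgen y; lia.
  by have := size_sgen (linv x); lia.
rewrite /= !drop0 sgen_linv fg_valV eq1 winv_cat eq4.
rewrite takel_cat // -(takel_cat c') // -eq6 eq2.
by rewrite !takel_cat // size_winv.
Qed.

Lemma take_sprod x w m : reduced (x :: w) -> m + l <= size (sgen x) ->
  take m (sprod (x :: w)) = take m (sgen x) :> seq (letter A).
Proof.
move=> /sprod_cons_split [a [b [c [eq1 _ eq3 lt_b]]]].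
by rewrite eq1 eq3 size_cat => le_m; rewrite !takel_cat //; lia.
Qed.

(** The prefix of [f] before [p] lies in the right coset of [H] through a prefix of a block. By
    [factor_inj] the window determines [x] and [s], hence this coset. *)
Definition visible f p := exists a x s,
  [/\ H a, s + l <= size (sgen x), take l (drop p f) = take l (drop s (sgen x)) &
      fgword (take p f) = a * fgword (take s (sgen x))].

(** The second [l] covers the letters at the end of the block that may cancel. *)
Lemma visible_sprod_cons x w p :
  reduced (x :: w) -> p + l + l <= size (sgen x) -> visible (sprod (x :: w)) p.
Proof.
move=> rw le_p; exists 1, x, p; split; try lia.
- exact: (@generated_sprod [::]).
- by rewrite !take_drop addnC take_sprod.
- by rewrite mul1g take_sprod //; lia.
Qed.

(** Left multiplication replaces the cancelled prefix [winv b] by [a]: later positions shift, and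
    later prefixes are multiplied by [sgen x], which lies in [H]. *)
Lemma visible_mull x a b c f p : sgen x = a ++ b :> seq (letter A) ->
    f = winv b ++ c :> seq (letter A) -> sgen x * f = a ++ c :> seq (letter A) ->
  size b <= p -> visible f p -> visible (sgen x * f) (p - size b + size a).
Proof.
move=> eq1 eq2 eq3 le_p [g [y [s [Hg le_s eq_l eq_g]]]].
have ltF : (p - size b + size a < size a) = false by lia.
exists (sgen x * g), y, s; split=> //.
- have [_ HM _] := generated_subgroup (range h); apply: HM => //.
  by have := generated_sprod [:: x]; rewrite /= mulg1.
- rewrite -eq_l eq2 eq3 !drop_cat size_winv ltF addnK.
  by rewrite ltnNge le_p.
- rewrite -mulgA -eq_g eq3 eq2 !take_cat size_winv ltF addnK ltnNge le_p /=.
  rewrite -(fgword_id (sgen x)) eq1 !fgword_cat fgword_winv.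
  by rewrite mulgA mulgK.
Qed.

(* A window of length [l] is visible unless it straddles a boundary between two
   blocks, and boundaries are more than [3 * l] apart. *)
Lemma visible_or w p d : reduced w -> l <= d <= l.*2 ->
  p + d + l <= size (sprod w) -> visible (sprod w) p \/ visible (sprod w) (p + d).
Proof.
elim: w p => [|x w IHw] p rw le_d; first by rewrite /=; lia.
have [a [b [c [eq1 eq2 eq3 lt_b]]]] := sprod_cons_split rw.
have sz1 : size (sgen x) = (size a + size b)%N by rewrite eq1 size_cat.
have sz2 : size (sprod w) = (size b + size c)%N by rewrite eq2 size_cat size_winv.
rewrite eq3 size_cat => le_p.
have lift q : size a <= q -> visible (sprod w) (q - size a + size b) ->
    visible (sprod (x :: w)) q.
  move=> le_q vis; have := visible_mull eq1 eq2 eq3 _ vis.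
  by rewrite addnK subnK //; apply; lia.
have rw' : reduced w := path_sorted rw.
have [le1|lt1] := leqP (size a) p.
  have [|?|?] := IHw (p - size a + size b) rw' le_d; first by lia.
    by left; exact: lift.
  right; apply: lift; first by lia.
  by rewrite (_ : (_ - _ + _ = p - size a + size b + d)%N); last lia.
have [le2|lt2] := leqP (p + l) (size a).
  left; exists 1, x, p; split; [exact: (@generated_sprod [::])|lia| |].
  - by rewrite eq1 eq3 !drop_cat lt1 !takel_cat // size_drop; lia.
  - by rewrite mul1g eq1 eq3 !takel_cat //; lia.
right; apply: lift; first by lia.
case: w => [|y w] in {IHw} rw rw' eq2 eq3 sz2 *.
  by have sz0 : (size b + size c)%N = 0 := esym sz2; lia.
(* This accounts for [5 * l]: the offset past the boundary is less than [2 * l], the cancelled part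
   is shorter than [l], and [visible_sprod_cons] asks for another [2 * l]. *)
by apply: visible_sprod_cons => //; have := size_sgen y; lia.
Qed.

(** Among the offsets [0], [l] and [l.*2], at most one fails for each word by [visible_or], so one
    of the three serves both. *)
Lemma visible_common w w' p p' :
  reduced w -> reduced w' -> p + 3 * l <= size (sprod w) ->
  p' + 3 * l <= size (sprod w') ->
  exists d, [/\ d <= l.*2, visible (sprod w) (p + d) & visible (sprod w') (p' + d)].
Proof.
move=> rw rw' le_p le_p'.
have ex (v : seq (letter I)) q d e : reduced v -> q + 3 * l <= size (sprod v) ->
    d + l <= e <= l.*2 ->
    visible (sprod v) (q + d) \/ visible (sprod v) (q + e).
  move=> rv le_q /andP[le_d le_e].
  have -> : (q + e)%N = (q + d + (e - d))%N by lia.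
  by apply: visible_or => //; lia.
have [] := ex w p 0 l rw le_p ltac:(lia);
have [] := ex w p 0 l.*2 rw le_p ltac:(lia);
have [] := ex w p l l.*2 rw le_p ltac:(lia);
have [] := ex w' p' 0 l rw' le_p' ltac:(lia);
have [] := ex w' p' 0 l.*2 rw' le_p' ltac:(lia);
have [] := ex w' p' l l.*2 rw' le_p' ltac:(lia) => *;
(by exists 0; split=> //; lia) || (by exists l; split=> //; lia) || by exists l.*2.
Qed.

Lemma malnormal_generated : malnormal H.
Proof.
have sH : subgroup H := generated_subgroup _.
have [H1 HM HV] := sH; split=> // g Hg; apply/seteqP; split; last first.
  by move=> _ ->; split=> //; exists 1; rewrite ?conj1g.
move=> _ [/[swap] -[f Hf <-] Hfg]; rewrite /set1 /=.
apply: contrapT => fg1; apply: Hg.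
have f1 : f != 1 by apply/eqP => f1; apply: fg1; rewrite f1 conj1g.
(* Cancellation with [g] costs at most twice its length, and [visible_common] needs a common factor
   of length [3 * l]. *)
have [N le_N] := size_expg_unbounded ((size g).*2 + 3 * l) f1.
have HX f' : H f' -> H (f' ^+ N).
  by move=> Hf'; elim: N {le_N} => // N IHN; rewrite expgS; apply: HM.
have [w rw def_f] := generatedP (HX _ Hf).
have [w' rw' def_fg] := generatedP (HX _ Hfg).
have eq_fg : sprod w * g = g * sprod w'.
  by rewrite -def_f -def_fg -conjXg conjgE mulgA mulgV mul1g.
rewrite def_f in le_N.
have [a [c [b [e [e' [eq1 eq2 le_c def_g]]]]]] := conjg_overlap eq_fg le_N.
have [||d [le_d vis vis']] := @visible_common w w' (size a) (size e) rw rw'.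
- by rewrite eq1 !size_cat; lia.
- by rewrite eq2 !size_cat; lia.
have window u z : take l (drop (size u + d) (u ++ c ++ z)) = take l (drop d c) /\
    take (size u + d) (u ++ c ++ z) = u ++ take d c.
  rewrite drop_cat take_cat ltnNge leq_addr /= addKn.
  have [lt_d le_d'] : d < size c /\ l <= size c - d by lia.
  by rewrite drop_cat lt_d !takel_cat ?size_drop // ltnW.
have [f1' [x [s [Hf1 le_s eq_s eq_f1]]]] := vis.
have [f2 [y [t [Hf2 le_t eq_t eq_f2]]]] := vis'.
have [win1 pre1] := window a b; have [win2 pre2] := window e e'.
rewrite eq1 win1 in eq_s; rewrite eq2 win2 in eq_t.
rewrite eq1 pre1 in eq_f1; rewrite eq2 pre2 in eq_f2.
have [eq_xy eq_st] : x = y /\ s = t by apply: factor_inj => //; rewrite -eq_s.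
subst y t; rewrite !fgword_cat in eq_f1 eq_f2.
(* The prefixes [a ++ take d c] and [e ++ take d c] lie in one right coset of [H], and [g] is their
   quotient. *)
suff -> : g = f1' * f2^-1 by apply: HM => //; exact: HV.
rewrite -(fgword_id g) def_g fgword_cat fgword_winv.
have -> : fgword a = f1' * fgword (take s (sgen x)) * (fgword (take d c))^-1.
  by rewrite -eq_f1 mulgK.
have -> : fgword e = f2 * fgword (take s (sgen x)) * (fgword (take d c))^-1.
  by rewrite -eq_f2 mulgK.
by rewrite mulgKA mulgKA.
Qed.

End GeneratedSubgroups.

(** * Counting words with determined letters *)

Section CountingWords.
Variable A : finType.
Implicit Types (x y : letter A) (w : seq (letter A)).

Notation q := #|{: letter A}|.-1.

Lemma reduced_rcons w x :
  reduced (rcons w x) =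
  reduced w && (if w is y :: w' then x != linv (last y w') else true).
Proof. by case: w => [|y w] //=; rewrite /reduced /= rcons_path. Qed.

Lemma card_rcons_tuples m (P : pred (seq (letter A))) :
  (forall w x, P (rcons w x) -> P w) ->
  #|[pred w : m.+1.-tuple (letter A) | P w]| =
  \sum_(w : m.-tuple (letter A) | P w) #|[pred x | P (rcons w x)]|.
Proof.
move=> closedP; pose f (p : m.-tuple (letter A) * letter A) := [tuple of rcons p.1 p.2].
have f_inj : injective f.
  by move=> [u x] [v y] /(congr1 val) /rcons_inj [/val_inj -> ->].
have f_bij : bijective f.
  apply: inj_card_bij f_inj _.
  by rewrite card_prod !card_tuple expnSr.
rewrite -sum1_card (reindex f) /=; last exact: onW_bij.
under [RHS]eq_bigr do rewrite -sum1_card.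
rewrite pair_big_dep /=; apply: eq_bigl => -[w x] /=; rewrite !inE /=.
by case: (boolP (P (rcons w x))) => [/closedP ->|]; rewrite ?andbF.
Qed.

Lemma card_rcons_reduced w : reduced w ->
  #|[pred x | reduced (rcons w x)]| = if w is [::] then #|{: letter A}| else q.
Proof.
case: w => [|y w] rw; last rewrite -(cardC1 (linv (last y w)));
  by apply: eq_card => x; rewrite !inE reduced_rcons rw.
Qed.

Lemma card_reduced_tuples_ge m :
  0 < #|A| -> q ^ m <= #|[pred w : m.-tuple (letter A) | reduced w]|.
Proof.
move=> A_gt0; elim: m => [|m IHm].
  by apply/card_gt0P; exists [tuple].
rewrite card_rcons_tuples => [|w x]; last by rewrite reduced_rcons => /andP[].
rewrite expnSr (leq_trans (leq_mul IHm (leqnn _))) // -sum_nat_const.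
apply: leq_sum => w rw; rewrite card_rcons_reduced //.
by case: (val w) => // ; rewrite leq_pred.
Qed.

Variables (x0 : letter A) (F : seq (letter A) -> letter A) (a l : nat).

(** The guard [j < size w] makes the condition pass to prefixes, so that words can be counted letter
    by letter. *)
Definition determined w : Prop :=
  forall j, a <= j < a + l -> j < size w -> nth x0 w j = F (take j w).

Let P w := reduced w && [forall j : 'I_(a + l),
  (a <= j) && (j < size w) ==> (nth x0 w j == F (take j w))].

Let P_determined w : reduced w -> determined w -> P w.
Proof.
move=> rw det_w; rewrite /P rw; apply/forallP => j; apply/implyP => /andP[le_j lt_j].
by apply/eqP/det_w => //; rewrite le_j /=.
Qed.

Let P_rcons w x : P (rcons w x) ->
  P w /\ (a <= size w < a + l -> x = F w).
Proof.
case/andP; rewrite reduced_rcons => /andP[rw _] /forallP Pw; split.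
  rewrite /P rw; apply/forallP => j; apply/implyP => /andP[le_j lt_j].
  have := Pw j; rewrite size_rcons le_j ltnS ltnW //= nth_rcons lt_j.
  by rewrite -cats1 takel_cat // ltnW.
move=> /andP[le_w lt_w]; have := Pw (Ordinal lt_w).
by rewrite /= le_w size_rcons leqnn nth_rcons ltnn eqxx -cats1 take_size_cat // => /eqP.
Qed.

(** A reduced word has [q] possible next letters, or [q.+1] if it is empty, but at most one at a
    determined position; [minn (m - a) l] counts the determined positions below [m]. *)
Let card_P_le m : 0 < q ->
  #|[pred w : m.-tuple (letter A) | P w]| * q ^ minn (m - a) l <= q.+1 * q ^ m.
Proof.
move=> q_gt0; have cardL : #|{: letter A}| = q.+1.
  by rewrite prednK //; apply/card_gt0P; exists x0.
elim: m => [|m IHm].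
  rewrite sub0n min0n expn0 muln1 (leq_trans (max_card _)) // card_tuple expn0.
  by rewrite muln1.
rewrite card_rcons_tuples => [|w x /P_rcons[]//].
have [in_m|out_m] := boolP (a <= m < a + l).
  have -> : minn (m.+1 - a) l = (minn (m - a) l).+1 by lia.
  rewrite !expnS (mulnCA q.+1) mulnCA leq_mul2l; apply/orP; right.
  apply: leq_trans IHm; rewrite leq_mul2r -[leqRHS]sum1_card; apply/orP; right.
  apply: leq_sum => w Pw; rewrite -(card1 (F w)); apply: subset_leq_card.
  by apply/fintype.subsetP => x; rewrite !inE => /P_rcons[_ ->] //; rewrite size_tuple.
have -> : minn (m.+1 - a) l = minn (m - a) l by lia.
case: m IHm out_m => [|m] IHm out_m.
  rewrite (_ : minn _ _ = 0); last by lia.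
  rewrite expn0 muln1 expn1 (leq_trans _ (leq_pmulr _ _)) //.
  rewrite -card_rcons_tuples => [|w x /P_rcons[]//].
  by rewrite (leq_trans (max_card _)) // card_tuple expn1 cardL.
rewrite [(q ^ m.+2)%N]expnS [(_.+1 * (_ * _))%N]mulnCA.
apply: leq_trans (leq_mul (leqnn _) IHm); rewrite mulnA leq_mul2r mulnC -sum_nat_const.
apply/orP; right; apply: leq_sum => w Pw; have /andP[rw _] := Pw.
apply: (@leq_trans #|[pred x | reduced (rcons w x)]|).
  by apply: subset_leq_card; apply/fintype.subsetP => x; rewrite !inE => /andP[].
by rewrite card_rcons_reduced //; case: w {Pw rw} => -[].
Qed.

Lemma card_determined_tuples m (Q : pred (seq (letter A))) : 0 < q ->
  (forall w, size w = m -> Q w -> reduced w /\ determined w) ->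
  #|[pred w : m.-tuple (letter A) | Q w]| * q ^ minn (m - a) l <= q.+1 * q ^ m.
Proof.
move=> q_gt0 QP; apply: leq_trans (card_P_le m q_gt0); rewrite leq_mul2r.
apply/orP; right; apply: subset_leq_card; apply/fintype.subsetP => w.
by rewrite !inE => /(QP _ (size_tuple w)) [/P_determined].
Qed.

Lemma card_reduced_le_sum n (E : pred (reduced_le A n)) (Q : pred (seq (letter A))) :
  (forall u, E u -> Q (val (val u))) ->
  #|E| <= \sum_(m < n.+1) #|[pred w : m.-tuple (letter A) | Q w]|.
Proof.
move=> EQ; rewrite -sum1_card.
rewrite (partition_big (fun u => inord (size (val (val u))) : 'I_n.+1) xpredT) //=.
apply: leq_sum => m _; rewrite sum1_card.
have sz (u : reduced_le A n) : inord (size (val (val u))) == m -> size (val (val u)) = m.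
  by move=> /eqP <-; rewrite inordK // ltnS; exact: size_bseq.
(* The default of [insubd] is never returned for words of length [m], the only ones in this
   fibre. *)
pose f (u : reduced_le A n) : m.-tuple (letter A) :=
  insubd (nseq_tuple m x0) (val (val u)).
have fE u : inord (size (val (val u))) == m -> f u = val (val u) :> seq _.
  by move=> /sz eq_m; rewrite /f val_insubd eq_m eqxx.
rewrite -(card_in_imset (f := f)); last first.
  move=> u v /andP[_ /fE fu] /andP[_ /fE fv] eq_f.
  by apply: val_inj; apply: val_inj; rewrite -fu -fv eq_f.
apply: subset_leq_card; apply/fintype.subsetP => w /imsetP[u].
by move=> /andP[/EQ Qu /fE fu] ->; rewrite inE fu.
Qed.

(** Lengths below [a + l] contribute nothing, and each of the others, at most [n.+1] in number,
    gains the full factor [q ^ l]. *)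
Lemma card_determined n (E : pred (reduced_le A n)) : 0 < q ->
  (forall u, E u -> a + l <= size (val (val u)) /\ determined (val (val u))) ->
  #|E| * q ^ l <= n.+1 * (q.+1 * q ^ n).
Proof.
move=> q_gt0 EP; pose Q w := P w && (a + l <= size w).
have EQ u : E u -> Q (val (val u)).
  by move=> /EP[le_u det_u]; rewrite /Q le_u P_determined //; exact: (valP u).
rewrite (leq_trans (leq_mul (card_reduced_le_sum EQ) (leqnn _))) //.
rewrite big_distrl /= -[X in (X * _)%N]card_ord -sum_nat_const; apply: leq_sum => m _.
have [le_m|lt_m] := leqP (a + l) m; last first.
  rewrite eq_card0 // => w; rewrite !inE /Q size_tuple leqNgt lt_m.
  by rewrite andbF.
apply: (@leq_trans (q.+1 * q ^ m)); last by rewrite leq_mul2l leq_pexp2l ?orbT // -ltnS.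
have {1}-> : l = minn (m - a) l by lia.
apply: card_determined_tuples => // w _ /andP[/andP[rw /forallP Pw] _].
split=> // j /andP[le_j lt_j] lt_w.
by have := Pw (Ordinal lt_j); rewrite /= le_j lt_w => /eqP.
Qed.

End CountingWords.

(** * Bounds on the number of reduced words *)

Section CountingReducedWords.
Variables (A : finType) (n : nat).
Hypothesis A_gt1 : 1 < #|A|.

Notation q := #|{: letter A}|.-1.

Lemma card_letter_gt3 : 3 < #|{: letter A}|.
Proof. by rewrite card_prod card_bool; lia. Qed.

Let q_gt0 : 0 < q.
Proof. by have := card_letter_gt3; lia. Qed.

Lemma exists_letter : exists x0 : letter A, true.
Proof. by case/card_gt0P: (ltnW A_gt1) => x; exists (x, true). Qed.

Lemma card_reduced_tuples_le m (Q : pred (seq (letter A))) :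
  (forall w, size w = m -> Q w -> reduced w) ->
  #|[pred w : m.-tuple (letter A) | Q w]| <= q.+1 * q ^ m.
Proof.
move=> QP; have [x0 _] := exists_letter.
rewrite -[leqLHS]muln1 -(expn0 q) -(minn0 (m - 0)).
(* With an empty range of determined positions, the bound applies to all reduced words. *)
apply: (card_determined_tuples (x0 := x0) (F := fun=> x0)) => // w sz /QP rw.
by split=> [|j]; [exact: rw | lia].
Qed.

Lemma card_reduced_le_le : #|{: reduced_le A n}| <= n.+1 * (q.+1 * q ^ n).
Proof.
have [x0 _] := exists_letter.
rewrite -[leqLHS]muln1 -(expn0 q).
by apply: (@card_determined _ x0 (fun=> x0) 0 0) => // u _; split=> // j; lia.
Qed.

Lemma card_reduced_le_ge : q ^ n <= #|{: reduced_le A n}|.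
Proof.
apply: leq_trans (card_reduced_tuples_ge n (ltnW A_gt1)) _.
have f_le (w : n.-tuple (letter A)) : size w <= n by rewrite size_tuple.
pose u0 : reduced_le A n := exist _ [bseq] isT.
pose f (w : n.-tuple (letter A)) : reduced_le A n := insubd u0 (Bseq (f_le w)).
have fE (w : n.-tuple (letter A)) : reduced w -> val (val (f w)) = w :> seq _.
  by move=> rw; rewrite /f val_insubd rw.
rewrite -(card_in_imset (f := f)) => [|u v]; first exact: max_card.
by rewrite !inE => /fE fu /fE fv eq_f; move: fu; rewrite eq_f fv => /val_inj.
Qed.

(** The lengths counted are at most [n - l], so each of them already gains a factor [q ^ l]. *)
Lemma card_short b l : b + l <= n.+1 ->
  #|[pred u : reduced_le A n | size (val (val u)) < b]| * q ^ l <= n.+1 * (q.+1 * q ^ n).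
Proof.
move=> le_b; have [x0 _] := exists_letter.
pose Q (w : seq (letter A)) := reduced w && (size w < b).
have EQ (u : reduced_le A n) : size (val (val u)) < b -> Q (val (val u)).
  by move=> lt_b; rewrite /Q lt_b andbT; exact: (valP u).
rewrite (leq_trans (leq_mul (card_reduced_le_sum x0 EQ) (leqnn _))) //.
rewrite big_distrl /= -[X in (X * _)%N]card_ord -sum_nat_const; apply: leq_sum => m _.
have [lt_m|le_m] := ltnP m b; last first.
  by rewrite eq_card0 // => w; rewrite !inE /Q size_tuple ltnNge le_m andbF.
apply: (@leq_trans (q.+1 * q ^ m * q ^ l)).
  by rewrite leq_mul2r card_reduced_tuples_le ?orbT // => w _ /andP[].
by rewrite -mulnA -expnD leq_mul2l leq_pexp2l ?orbT //; lia.
Qed.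

End CountingReducedWords.

(** * Resampling one entry of a tuple, and the union bound *)

Section TupleCounting.
Variables (T : finType) (k : nat).

Definition tset (t : k.-tuple T) (i : 'I_k) (u : T) : k.-tuple T :=
  [tuple if j == i then u else tnth t j | j < k].

Lemma tnth_tset t i u j : tnth (tset t i u) j = if j == i then u else tnth t j.
Proof. exact: tnth_mktuple. Qed.

(** Exchanging entry [i] with a fresh [u] is an involution on pairs, so the pairs with [E t] are as
    many as those with [E (tset t i u)]. *)
Lemma card_tuple_fiber (E : pred (k.-tuple T)) (i : 'I_k) Q c :
  (forall t, #|[pred u | E (tset t i u)]| * Q <= c) ->
  #|T| * #|E| * Q <= c * #|T| ^ k.
Proof.
move=> fiber_le.
pose g (p : k.-tuple T * T) := (tset p.1 i p.2, tnth p.1 i).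
have gK : involutive g.
  move=> [t u]; rewrite /g /= tnth_tset eqxx; congr (_, _).
  by apply: eq_from_tnth => j; rewrite !tnth_tset; case: eqP => // ->.
have -> : #|T| * #|E| = \sum_(t : k.-tuple T) #|[pred u | E (tset t i u)]|.
  under [RHS]eq_bigr do rewrite -sum1_card.
  rewrite pair_big_dep /= (reindex_inj (inv_inj gK)) /= mulnC -sum_nat_const.
  under [LHS]eq_bigr do rewrite -sum1_card.
  rewrite pair_big_dep /=; apply: eq_bigl => -[t u] /=.
  have /(congr1 fst) /= := gK (t, u).
  by rewrite !inE /= andbT => ->.
rewrite big_distrl /= mulnC -card_tuple -sum_nat_const.
exact: leq_sum.
Qed.

Lemma card_le_sum (S I : finType) (B : pred S) (E : I -> pred S) :
  (forall t, B t -> exists i, E i t) -> #|B| <= \sum_i #|E i|.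
Proof.
move=> BE; under eq_bigr do rewrite -sum1_card big_mkcond.
rewrite exchange_big -sum1_card big_mkcond /=.
apply: leq_sum => t _; case: ifP => // /BE[i Ei].
by rewrite (bigD1 i) //= ifT.
Qed.

End TupleCounting.

(** * Coincidences between factors of the entries *)

Section Clashes.
Variable A : finType.
Implicit Types u v : seq (letter A).

(** For [e] false the position [t] still refers to [v] and only the factor is inverted;
    [take_drop_winv] translates factors of inverse words to this form. *)
Definition clash l (e : bool) s t u v :=
  [&& s + l <= size u, t + l <= size v &
    take l (drop s u) ==
      if e then take l (drop t v) else winv (take l (drop t v))].

Lemma clash_nth x0 l e s t u v j : clash l e s t u v -> j < l ->
  nth x0 u (s + j) =
    if e then nth x0 v (t + j) else linv (nth x0 v (t + l - j.+1)).
Proof.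
case/and3P => le_s le_t /eqP eq_uv lt_j.
rewrite -nth_drop -(nth_take _ lt_j) eq_uv; case: e {eq_uv}.
  by rewrite nth_take // nth_drop.
have sz : size (take l (drop t v)) = l by rewrite size_takel // size_drop; lia.
rewrite nth_winv sz // nth_take ?nth_drop; last by lia.
by rewrite addnBA.
Qed.

Lemma take_drop_winv l s u : s + l <= size u ->
  take l (drop s (winv u)) = winv (take l (drop (size u - s - l) u)).
Proof.
move=> le_s; rewrite /winv drop_rev take_rev !size_take size_map.
rewrite take_drop map_drop map_take; congr (rev (drop _ (take _ _))); last by lia.
by case: ltnP; lia.
Qed.

Variables n l : nat.
Hypothesis A_gt1 : 1 < #|A|.
Hypothesis l_gt0 : 0 < l.
Notation q := #|{: letter A}|.-1.
Notation wd w := (val (val w)).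

Let q_gt0 : 0 < q.
Proof. by have := card_letter_gt3 A_gt1; lia. Qed.

(** With [v] fixed, the window of [u] at [s] is dictated letter by letter; [F] reads only the length
    of the prefix. *)
Lemma card_clash_other e s t v :
  #|[pred u : reduced_le A n | clash l e s t (wd u) v]| * q ^ l
  <= n.+1 * (q.+1 * q ^ n).
Proof.
have [x0 _] := exists_letter A_gt1.
pose F (p : seq (letter A)) := if e then nth x0 v (t + (size p - s))
  else linv (nth x0 v (t + l - (size p - s).+1)).
apply: (card_determined (x0 := x0) (F := F) (a := s)) => // u cl; split.
  by case/and3P: cl.
move=> j /andP[le_j lt_j] lt_ju; have {1}-> : j = s + (j - s) by lia.
rewrite (clash_nth x0 cl); last by lia.
by rewrite /F size_takel // ltnW.
Qed.

(** The later window is determined by the earlier one. For equal orientations an overlap is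
    harmless, since each letter copies one strictly before it. For opposite orientations an overlap
    would reflect the word onto its inverse about a centre, against reducedness. *)
Lemma card_clash_self e s t : ~~ (e && (s == t)) ->
  #|[pred u : reduced_le A n | clash l e s t (wd u) (wd u)]| * q ^ l
  <= n.+1 * (q.+1 * q ^ n).
Proof.
move=> neq; have [x0 _] := exists_letter A_gt1.
pose F a (p : seq (letter A)) :=
  if e then nth x0 p (size p - a + minn s t)
  else linv (nth x0 p (minn s t + l - (size p - a).+1)).
have [far|near] := boolP (e || (s + l <= t) || (t + l <= s)); last first.
  rewrite eq_card0 // => u; rewrite !inE; apply/negP => cl.
  have ru : reduced (wd u) := valP u.
  have /and3P[le_s le_t _] := cl.
  (* The coincidence pairs positions with sum [(s + t + l).-1]; these are the central two. *)
  have [i [j [le_ij eq_ij lt_ij]]] :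
      exists i j, [/\ i <= j, i + j = (s + t + l).-1 & j <= i.+1].
    exists ((s + t + l).-1)./2, ((s + t + l).-1 - ((s + t + l).-1)./2).
    by split; lia.
  apply: (reflected_not_reduced (x0 := x0) (i := i) (j := j) ru); first by lia.
  move=> m le_m; have -> : m = 0 by lia.
  rewrite addn0 subn0; have -> : i = s + (i - s) by lia.
  rewrite (clash_nth x0 cl); last by lia.
  by move: near; case: (e) => //= near; congr (linv (nth _ _ _)); lia.
apply: (card_determined (x0 := x0) (F := F (maxn s t)) (a := maxn s t)) => //.
move=> u cl; have /and3P[le_s le_t _] := cl; split; first by lia.
move=> j /andP[le_j lt_j] lt_ju; rewrite /F size_takel 1?ltnW //.
have cl_nth m : m < l -> nth x0 (wd u) (s + m) =
    if e then nth x0 (wd u) (t + m) else linv (nth x0 (wd u) (t + l - m.+1)).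
  exact: clash_nth.
move: neq far cl_nth; case: (e) => /= neq far cl_nth.
  rewrite nth_take; last by lia.
  have [lt_st|le_ts] := ltnP s t.
    have := cl_nth (j - t) ltac:(lia).
    rewrite (_ : t + (j - t) = j); last by lia.
    by move=> <-; congr (nth _ _ _); lia.
  have := cl_nth (j - s) ltac:(lia).
  rewrite (_ : s + (j - s) = j); last by lia.
  by move=> ->; congr (nth _ _ _); lia.
rewrite nth_take; last by lia.
have [le_st|lt_ts] := leqP s t.
  have := cl_nth (t + l - j.+1) ltac:(lia).
  rewrite (_ : t + l - (t + l - j.+1).+1 = j); last by lia.
  move/(congr1 (@linv A)); rewrite linvK => <-.
  by congr (linv (nth _ _ _)); lia.
have := cl_nth (j - s) ltac:(lia).
rewrite (_ : s + (j - s) = j); last by lia.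
by move=> ->; congr (linv (nth _ _ _)); lia.
Qed.

Variable k : nat.
Implicit Type t : k.-tuple (reduced_le A n).

Lemma malnormal_no_clash t : (forall i, 5 * l <= size (wd (tnth t i))) ->
  (forall i j e s s', clash l e s s' (wd (tnth t i)) (wd (tnth t j)) ->
    [&& i == j, e & s == s']) ->
  malnormal (tuple_subgroup t).
Proof.
move=> size_t no_clash; pose h i := to_freegroup (tnth t i).
pose W i : seq (letter A) := wd (tnth t i).
apply: (malnormal_generated (h := h) (l := l)) => // -[i e] [j e'] s s'.
have sgenE x : sgen h x = (if x.2 then W x.1 else winv (W x.1)) :> seq (letter A).
  by case: x => ? [].
rewrite !sgenE.
have noc i' j' d r r' : r + l <= size (W i') -> r' + l <= size (W j') ->
    take l (drop r (W i')) =
      (if d then take l (drop r' (W j')) else winv (take l (drop r' (W j')))) ->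
    [/\ i' = j', d & r = r'].
  move=> le_r le_r' eq_r; have := no_clash i' j' d r r'.
  by rewrite /clash le_r le_r' eq_r eqxx => /(_ isT)/and3P[/eqP-> -> /eqP->].
(* Equal signs give a coincidence with [e] true, opposite signs one with [e] false. Positions in
   inverses are read from the other end. *)
case: e; case: e' => /=; rewrite ?size_winv => le_s le_s' eq_f.
- by have [-> _ ->] := noc i j true s s' le_s le_s' eq_f.
- rewrite (take_drop_winv le_s') in eq_f.
  by have [|_ //] := noc i j false s _ le_s _ eq_f; lia.
- rewrite (take_drop_winv le_s) in eq_f.
  move/(congr1 (@winv A)): eq_f; rewrite winvK => eq_f.
  by have [|_ //] := noc i j false _ s' _ le_s' eq_f; lia.
- rewrite (take_drop_winv le_s) (take_drop_winv le_s') in eq_f.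
  have [||eq_ij _ eq_s] := noc i j true _ _ _ _ (can_inj (@winvK A) eq_f); [lia|lia|].
  by move: le_s' eq_s; rewrite -eq_ij => le_s' eq_s; split=> //; lia.
Qed.

Lemma card_not_malnormal (B : pred (k.-tuple (reduced_le A n))) :
  7 * l <= n -> (forall t, B t -> ~ malnormal (tuple_subgroup t)) ->
  #|B| * q ^ l <= 3 * k ^ 2 * n.+1 ^ 3 * q.+1 * #|{: reduced_le A n}| ^ k.
Proof.
move=> le_n BP; set N := #|{: reduced_le A n}|.
(* The bad events: an entry that is too short, or a forbidden coincidence of two windows. *)
pose I := ('I_k + 'I_k * 'I_k * bool * 'I_n.+1 * 'I_n.+1)%type.
pose E (x : I) : pred (k.-tuple (reduced_le A n)) := match x with
  | inl i => [pred t | size (wd (tnth t i)) < 5 * l]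
  | inr (i, j, e, s, s') => [pred t | clash l e s s' (wd (tnth t i)) (wd (tnth t j))
      && ~~ [&& i == j, e & s == s' :> nat]]
  end.
have BE t : B t -> exists x, E x t.
  move=> /BP bad; apply: contrapT => noE; apply: bad; apply: malnormal_no_clash.
    move=> i; rewrite leqNgt; apply/negP => short.
    by apply: noE; exists (inl i).
  move=> i j e s s' cl; apply: contrapT => neq; apply: noE.
  have /and3P[le_s le_s' _] := cl.
  have lt_s : s < n.+1 by have := size_bseq (val (tnth t i)); move: le_s => /=; lia.
  have lt_s' : s' < n.+1 by have := size_bseq (val (tnth t j)); move: le_s' => /=; lia.
  exists (inr (i, j, e, Ordinal lt_s, Ordinal lt_s')); rewrite /= cl /=.
  exact/negP.
have E_le x : N * #|E x| * q ^ l <= n.+1 * (q.+1 * q ^ n) * N ^ k.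
  case: x => [i|[[[[i j] e] s] s']].
    apply: (card_tuple_fiber (i := i)) => t.
    rewrite -/N (eq_card (B := [pred u : reduced_le A n | size (wd u) < 5 * l])).
      by apply: card_short => //; lia.
    by move=> u; rewrite !inE /= tnth_tset eqxx.
  apply: (card_tuple_fiber (i := i)) => t.
  have [eq_ij|neq_ij] := eqVneq i j; last first.
    apply: leq_trans (card_clash_other e s s' (wd (tnth t j))).
    rewrite leq_mul2r; apply/orP; right; apply: subset_leq_card.
    apply/fintype.subsetP => u; rewrite !inE /= !tnth_tset eqxx.
    by rewrite eq_sym (negPf neq_ij) => /andP[].
  subst j; have [triv|nontriv] := boolP (e && (s == s' :> nat)).
    by rewrite eq_card0 // => u; rewrite !inE /= eqxx triv andbF.
  apply: leq_trans (card_clash_self nontriv).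
  rewrite leq_mul2r; apply/orP; right; apply: subset_leq_card.
  by apply/fintype.subsetP => u; rewrite !inE /= !tnth_tset eqxx => /andP[].
have cardI : #|{: I}| <= 3 * k ^ 2 * n.+1 ^ 2.
  rewrite card_sum !card_prod !card_ord card_bool.
  have : k <= k ^ 2 * n.+1 ^ 2.
    by rewrite -[leqLHS]muln1 leq_mul ?expn_gt0 //; case: (k) => // m; nia.
  by nia.
have le_B : N * #|B| * q ^ l <= #|{: I}| * (n.+1 * (q.+1 * q ^ n) * N ^ k).
  apply: (@leq_trans (N * (\sum_x #|E x|) * q ^ l)).
    by rewrite leq_mul2r leq_mul2l (card_le_sum BE) !orbT.
  rewrite big_distrr big_distrl /= -sum_nat_const.
  by apply: leq_sum => x _.
have N_ge : q ^ n <= N by apply: card_reduced_le_ge.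
(* The factor [N] from resampling one entry is at least [q ^ n], which then cancels. *)
rewrite -(@leq_pmul2l (q ^ n)) ?expn_gt0 ?q_gt0 // mulnA.
apply: leq_trans (leq_mul (leq_mul N_ge (leqnn _)) (leqnn _)) _.
apply: leq_trans le_B _; apply: leq_trans (leq_mul cardI (leqnn _)) _.
by rewrite eq_leq //; ring.
Qed.

End Clashes.

(** * Exponential decay and arithmetic of exponents *)

Section Asymptotics.
Variable R : realType.
Local Open Scope ring_scope.
Local Open Scope classical_set_scope.

(* A power of [p] decays exponentially up to a polynomial factor, which half of
   the exponential absorbs because [1 + x <= expR x]. *)
Lemma littleo_expR (p : nat -> R) (C lam : R) (m a n0 : nat) :
  (0 < m)%N -> 0 < lam <= 1 -> (forall n, 0 <= p n) ->
  (forall n, (n0 <= n)%N -> p n ^+ m * expR (lam * n%:R) <= C * n.+1%:R ^+ a) ->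
  exists2 c : R, 0 < c & p =o_\oo (fun n => expR (- (c * n%:R))).
Proof.
move=> m_gt0 /andP[lam_gt0 lam_le1] p_ge0 p_le; pose c := lam / 2 / m%:R.
have mR : 0 < m%:R :> R by rewrite ltr0n.
exists c; first by rewrite !divr_gt0.
apply/eqoP => eps eps_gt0.
(* Chosen so that [lam / 2 * n] is [a.+1] times [n / D]. The power [a.+1] instead of [a] leaves a
   spare factor [n.+1] to outgrow the constants. *)
pose D : R := 2 * a.+1%:R / lam.
have aR : 1 <= a.+1%:R :> R by rewrite ler1n.
have D_ge1 : 1 <= D by rewrite /D ler_pdivlMr // mul1r; lra.
have D_gt0 : 0 < D by lra.
have poly_le n : n.+1%:R ^+ a.+1 <= D ^+ a.+1 * expR (lam / 2 * n%:R) :> R.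
  have -> : lam / 2 * n%:R = (n%:R / D) * a.+1%:R :> R.
    by rewrite /D; field; apply/andP; split; lra.
  have E_ge0 : 0 <= D * expR (n%:R / D) by apply: mulr_ge0 (expR_ge0 _); lra.
  rewrite expRM_natr -exprMn lerXn2r ?nnegrE ?ler0n //.
  apply: (@le_trans _ _ (D * (1 + n%:R / D))); last by rewrite ler_pM2l // expR_ge1Dx.
  rewrite mulrDr mulr1 mulrC divfK ?gt_eqF // -natr1; lra.
near=> n.
rewrite (ger0_norm (p_ge0 n)) ger0_norm ?expR_ge0 // expRN ler_pdivlMr ?expR_gt0 //.
have le_n0 : (n0 <= n)%N by near: n; exact: nbhs_infty_ge.
have le_n : C * D ^+ a.+1 / eps ^+ m <= n%:R by near: n; exact: nbhs_infty_ger.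
set E := expR (lam / 2 * n%:R).
have E_gt0 : 0 < E by exact: expR_gt0.
have EE : expR (lam * n%:R) = E * E by rewrite -expRD; congr expR; field.
have /= le1 := p_le n le_n0; rewrite EE in le1.
have nR : 0 < n.+1%:R :> R by rewrite ltr0n.
have C_ge0 : 0 <= C.
  have : 0 <= C * n.+1%:R ^+ a.
    by apply: le_trans le1; rewrite !mulr_ge0 ?exprn_ge0 ?p_ge0 ?(ltW E_gt0).
  by rewrite pmulr_lge0 // exprn_gt0.
have le2 : p n ^+ m * E * n.+1%:R <= C * D ^+ a.+1.
  rewrite -(ler_pM2r E_gt0).
  apply: (@le_trans _ _ (C * n.+1%:R ^+ a.+1)).
    rewrite (_ : p n ^+ m * E * n.+1%:R * E = p n ^+ m * (E * E) * n.+1%:R); last by ring.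
    by rewrite exprSr (mulrA C) ler_pM2r.
  by rewrite -mulrA ler_wpM2l // poly_le.
have le3 : C * D ^+ a.+1 <= eps ^+ m * n.+1%:R.
  rewrite [leRHS]mulrC -ler_pdivrMr ?exprn_gt0 // -natr1; lra.
have le4 : p n ^+ m * E <= eps ^+ m by rewrite -(ler_pM2r nR) (le_trans le2).
rewrite -(@ler_pXn2r _ m) ?nnegrE ?(ltW eps_gt0) ?mulr_ge0 ?p_ge0 ?expR_ge0 //.
rewrite exprMn -expRM_natr (_ : c * n%:R * m%:R = lam / 2 * n%:R) //.
by rewrite /c; field; lra.
Unshelve. all: by end_near. Qed.

Lemma expR_half_le2 : expR (1 / 2) <= 2 :> R.
Proof.
have E_gt0 := expR_gt0 (1 / 2 : R).
have := expR_ge1Dx (- (1 / 2) : R); rewrite expRN.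
rewrite -(ler_pM2r E_gt0) mulVf ?gt_eqF // => le1; lra.
Qed.

End Asymptotics.

(** The bound on [d] enters the count in this integral form; [k ^ 16] is the eighth power of the
    factor [k ^ 2] that counts pairs of entries. *)
Lemma tuple_size_expn_le (R : realType) (A : finType) (d : R) n :
  (0 < #|{: reduced_le A n}|)%N -> (d < 1 / 16)%R ->
  tuple_size A d n ^ 16 <= #|{: reduced_le A n}|.
Proof.
set N := #|_| => N_gt0 lt_d; rewrite -(ler_nat R) natrX.
have N_ge1 : (1 <= N%:R :> R)%R by rewrite ler1n.
apply: (@le_trans _ _ ((N%:R `^ (1 / 16) : R) ^+ 16)%R).
  rewrite lerXn2r ?nnegrE ?ler0n ?powR_ge0 //.
  apply: (@le_trans _ _ (N%:R `^ d)%R); last by rewrite ler_powR // ltW.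
  by rewrite /tuple_size truncn_le powR_ge0.
rewrite -powR_mulrn ?powR_ge0 // -powRrM (_ : 1 / 16 * 16%:R = 1 :> R)%R ?powRr1 ?ler0n //.
by field.
Qed.

(* The two bounds are combined after raising to the powers 8 and 7, so that all
   the exponents are natural numbers. *)
Lemma expn_bound (b c k l m n q s N T : nat) : 0 < q -> 7 * l + 6 >= n ->
  b * q ^ l <= c * k ^ 2 * m ^ 3 * s * T -> k ^ 16 <= N -> N <= m * (s * q ^ n) ->
  b ^ 56 * q ^ n <= c ^ 56 * s ^ 63 * q ^ 48 * m ^ 175 * T ^ 56.
Proof.
move=> q_gt0 le_n le_b le_k le_N.
(* Rounding in [l] costs at most [q ^ 48]. Of the exponent [8 * n], a part [7 * n] pays for the
   bound on [N] and [n] remains. *)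
have le_q : q ^ (n + n * 7) <= q ^ (l * 56 + 48).
  by rewrite leq_pexp2l //; clear -le_n; lia.
have le8 : b ^ 8 * q ^ (l * 8) <= c ^ 8 * m ^ 25 * s ^ 9 * q ^ n * T ^ 8.
  apply: (@leq_trans (c ^ 8 * k ^ 16 * m ^ 24 * s ^ 8 * T ^ 8)).
    have : (b * q ^ l) ^ 8 <= (c * k ^ 2 * m ^ 3 * s * T) ^ 8 by rewrite leq_exp2r.
    by rewrite (expnMn _ T) (expnMn _ s) (expnMn _ (m ^ 3)) (expnMn c) (expnMn b) -!expnM.
  apply: (@leq_trans (c ^ 8 * (m * (s * q ^ n)) * m ^ 24 * s ^ 8 * T ^ 8)).
    do 3![apply: leq_mul (leqnn _)]; exact: leq_mul (leqnn _) (leq_trans le_k le_N).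
  by rewrite (expnS m 24) (expnS s 8) eq_leq //; lia.
have le56 : b ^ 56 * q ^ (l * 56) <= c ^ 56 * m ^ 175 * s ^ 63 * q ^ (n * 7) * T ^ 56.
  have : (b ^ 8 * q ^ (l * 8)) ^ 7 <= (c ^ 8 * m ^ 25 * s ^ 9 * q ^ n * T ^ 8) ^ 7.
    by rewrite leq_exp2r.
  rewrite (expnMn _ (T ^ 8)) (expnMn _ (q ^ n)) (expnMn _ (s ^ 9)) (expnMn _ (m ^ 25)).
  by rewrite (expnMn (b ^ 8)) -!expnM -mulnA.
rewrite -(@leq_pmul2r (q ^ (n * 7))) ?expn_gt0 ?q_gt0 //.
rewrite -mulnA -expnD; apply: (@leq_trans (b ^ 56 * (q ^ (l * 56) * q ^ 48))).
  by rewrite -expnD; exact: leq_mul.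
rewrite mulnA; apply: leq_trans (leq_mul le56 (leqnn _)) _.
by rewrite eq_leq //; lia.
Qed.

(** * The probability estimate *)

Local Open Scope ring_scope.

Theorem proposition3p22 (R : realType) (A : finType) (d : R)
    (card_A : (2 <= #|A|)%N) (d_gt0 : 0 < d) (d_lt : d < 1 / 16) :
  exp_generic R
    (fun (n : nat) (t : (tuple_size A d n).-tuple (reduced_le A n)) =>
       malnormal (tuple_subgroup t)).
Proof.
set q := #|{: letter A}|.-1.
have q_ge3 : (2 < q)%N by rewrite /q; have := card_letter_gt3 card_A; lia.
pose C : R := (3 ^ 56 * q.+1 ^ 63 * q ^ 48)%N%:R.
(* The exponents [8 * 7] and [25 * 7] come from [expn_bound], [n >= 7] makes [n %/ 7] positive, and
   the rate [1 / 2] works since [expR (1 / 2) <= 2 <= q]. *)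
apply: (@littleo_expR R _ C (1 / 2) 56 175 7) => //; first lra.
  by move=> n; rewrite divr_ge0 ?ler0n.
move=> n n_ge7; rewrite /unif_prob card_tuple.
set B := [pred t | _]; set N := #|{: reduced_le A n}|; set k := tuple_size A d n.
have N_ge : (q ^ n <= N)%N by apply: card_reduced_le_ge.
have N_gt0 : (0 < N)%N by apply: leq_trans N_ge; rewrite expn_gt0; lia.
have T_gt0 : 0 < ((N ^ k)%N%:R : R) ^+ 56.
  by rewrite exprn_gt0 // ltr0n expn_gt0 N_gt0.
have B_le : (#|B| * q ^ (n %/ 7) <= 3 * k ^ 2 * n.+1 ^ 3 * q.+1 * N ^ k)%N.
  apply: card_not_malnormal => //; [lia|lia|].
  by move=> t /asboolP.
have bound : (#|B| ^ 56 * q ^ n <=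
    3 ^ 56 * q.+1 ^ 63 * q ^ 48 * n.+1 ^ 175 * (N ^ k) ^ 56)%N.
  apply: expn_bound B_le (tuple_size_expn_le N_gt0 d_lt) _; [lia|lia|].
  exact: card_reduced_le_le.
rewrite expr_div_n mulrAC ler_pdivrMr //.
apply: (@le_trans _ _ ((#|B| ^ 56 * q ^ n)%N%:R)); last first.
  rewrite /C -!natrX -!natrM ler_nat; exact: bound.
rewrite natrM !natrX ler_wpM2l ?exprn_ge0 ?ler0n // expRM_natr.
rewrite lerXn2r ?nnegrE ?expR_ge0 ?ler0n // (le_trans (expR_half_le2 R)) //.
by rewrite ler_nat ltnW.
Qed.
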